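(* The graph $T$ (defined in the context) is a simple maximal planar graph with \[ |V(T)|=31,\qquad |E(T)|=87,\qquad a(T)=15. \] Its degree multiset is $4^1\,5^{17}\,6^6\,7^7$, i.e. $T$ has exactly one vertex of degree $4$, seventeen vertices of degree $5$, six vertices of degree $6$ and seven vertices of degree $7$.
   Context: For a finite graph $G$, $a(G)$ denotes the maximum number of vertices in an induced forest of $G$, i.e. the maximum of $|F|$ over $F\subseteq V(G)$ with $G[F]$ acyclic. The gadget $X$. Let $X$ be the simple graph on the $14$ vertices $a,b,c,d,e,f,g,h,i,j,k,l,m,n$ with neighbourhoods $N(a)=\{b,c,d,e,f,g\}$, $N(b)=\{a,g,h,i,j,c\}$, $N(c)=\{a,b,j,k,d\}$, $N(d)=\{a,c,k,l,e\}$, $N(e)=\{a,d,l,m,f\}$, $N(f)=\{a,e,m,i,h,g\}$, $N(g)=\{a,f,h,b\}$, $N(h)=\{b,g,f,i\}$, $N(i)=\{b,h,f,m,n,j\}$, $N(j)=\{b,i,n,k,c\}$, $N(k)=\{c,j,n,l,d\}$, $N(l)=\{d,k,n,m,e\}$, $N(m)=\{e,l,n,i,f\}$, $N(n)=\{i,m,l,k,j\}$. It has $36$ edges. The adjacent vertices $g,h$ are called its terminals; the other twelve vertices are its internal vertices. The graph $T$. The vertex set is $\{0,1,\dots,30\}$. The edges are the following. (1) The edges of the pentagonal bipyramid on $\{0,\dots,6\}$: the rim edges $01,12,23,34,40$ and all edges joining each of the two (nonadjacent) apices $5,6$ to each of $0,1,2,3,4$. (2) The edges of a first copy of $X$, obtained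 by mapping $g\mapsto 0$, $h\mapsto 1$ and $(a,b,c,d,e,f,i,j,k,l,m,n)\mapsto(7,8,9,10,11,12,13,14,15,16,17,18)$; the terminal edge $gh$ is identified with the existing edge $01$. (3) The edges of a second copy of $X$, obtained by mapping $g\mapsto 2$, $h\mapsto 3$ and $(a,b,c,d,e,f,i,j,k,l,m,n)\mapsto(19,20,21,22,23,24,25,26,27,28,29,30)$; the terminal edge $gh$ is identified with the existing edge $23$. (4) The two additional edges joining $6$ to $12$ and $6$ to $20$. *)

(* Defs.v *)
From mathcomp Require Import all_boot all_order all_algebra.
From mathcomp Require Import boolp classical_sets functions set_interval.
From mathcomp Require Import reals topology normedtype.
Set Implicit Arguments.
Unset Strict Implicit.
Unset Printing Implicit Defensive.
Import Order.TTheory GRing.Theory Num.Theory.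
Import numFieldNormedType.Exports.
Local Open Scope classical_set_scope.
Local Open Scope ring_scope.

(* A simple graph on a finType V is a symmetric irreflexive e : rel V. *)
Definition simple_graph (V : finType) (e : rel V) : Prop :=
  symmetric e /\ irreflexive e.

Definition edges (V : finType) (e : rel V) : {set {set V}} :=
  [set [set u.1; u.2]%SET | u : V * V & e u.1 u.2]%SET.

Definition degree (V : finType) (e : rel V) (x : V) : nat :=
  #|[set y | e x y]%SET|.

Definition induces_forest (V : finType) (e : rel V) (F : {set V}) : Prop :=
  forall c : seq V,
    {subset c <= F} -> (3 <= size c)%N -> ~ (cycle e c /\ uniq c).

(* This is a(G). *)
Definition forest_number (V : finType) (e : rel V) : nat :=
  (\max_(F : {set V} | `[< induces_forest e F >]) #|F|)%N.

Definition arc_between (R : realType) (p q : R * R) (A : set (R * R)) : Prop :=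
  exists f : R -> R * R,
    [/\ {within `[0, 1], continuous f},
        {in `[0, 1] &, injective f},
        f 0 = p, f 1 = q & f @` `[0, 1] = A].

(* Only the values of arc on edges of the graph matter. *)
Definition plane_drawing (R : realType) (V : finType) (e : rel V)
    (pos : V -> R * R) (arc : {set V} -> set (R * R)) : Prop :=
  [/\ injective pos,
      forall x y, e x y -> arc_between (pos x) (pos y) (arc [set x; y]%SET),
      forall E z, E \in edges e -> arc E (pos z) -> z \in E
    & forall E E', E \in edges e -> E' \in edges e -> E != E' ->
        forall p, arc E p -> arc E' p ->
          exists2 z, z \in (E :&: E')%SET & p = pos z].

Definition planar (R : realType) (V : finType) (e : rel V) : Prop :=
  exists (pos : V -> R * R) (arc : {set V} -> set (R * R)),
    plane_drawing e pos arc.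

Definition add_edge (V : finType) (e : rel V) (x y : V) : rel V :=
  [rel u v | e u v || ([set u; v]%SET == [set x; y]%SET)].

Definition maximal_planar (R : realType) (V : finType) (e : rel V) : Prop :=
  planar R e /\
  forall x y, x != y -> ~~ e x y -> ~ planar R (add_edge e x y).

Variant gadget : Set :=
  | Xa | Xb | Xc | Xd | Xe | Xf | Xg | Xh | Xi | Xj | Xk | Xl | Xm | Xn.

Definition gadget_vertices : seq gadget :=
  [:: Xa; Xb; Xc; Xd; Xe; Xf; Xg; Xh; Xi; Xj; Xk; Xl; Xm; Xn].

Definition gadget_nbrs (v : gadget) : seq gadget :=
  match v with
  | Xa => [:: Xb; Xc; Xd; Xe; Xf; Xg]
  | Xb => [:: Xa; Xg; Xh; Xi; Xj; Xc]
  | Xc => [:: Xa; Xb; Xj; Xk; Xd]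
  | Xd => [:: Xa; Xc; Xk; Xl; Xe]
  | Xe => [:: Xa; Xd; Xl; Xm; Xf]
  | Xf => [:: Xa; Xe; Xm; Xi; Xh; Xg]
  | Xg => [:: Xa; Xf; Xh; Xb]
  | Xh => [:: Xb; Xg; Xf; Xi]
  | Xi => [:: Xb; Xh; Xf; Xm; Xn; Xj]
  | Xj => [:: Xb; Xi; Xn; Xk; Xc]
  | Xk => [:: Xc; Xj; Xn; Xl; Xd]
  | Xl => [:: Xd; Xk; Xn; Xm; Xe]
  | Xm => [:: Xe; Xl; Xn; Xi; Xf]
  | Xn => [:: Xi; Xm; Xl; Xk; Xj]
  end.

Definition gadget_copy (phi : gadget -> nat) : seq (nat * nat) :=
  [seq (phi u, phi v) | u <- gadget_vertices, v <- gadget_nbrs u].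

Definition copy1 (v : gadget) : nat :=
  match v with
  | Xg => 0 | Xh => 1
  | Xa => 7 | Xb => 8 | Xc => 9 | Xd => 10 | Xe => 11 | Xf => 12
  | Xi => 13 | Xj => 14 | Xk => 15 | Xl => 16 | Xm => 17 | Xn => 18
  end%N.

Definition copy2 (v : gadget) : nat :=
  match v with
  | Xg => 2 | Xh => 3
  | Xa => 19 | Xb => 20 | Xc => 21 | Xd => 22 | Xe => 23 | Xf => 24
  | Xi => 25 | Xj => 26 | Xk => 27 | Xl => 28 | Xm => 29 | Xn => 30
  end%N.

Definition bipyramid : seq (nat * nat) :=
  [:: (0, 1); (1, 2); (2, 3); (3, 4); (4, 0)]%N ++
  [seq (apex, r) | apex <- [:: 5; 6]%N, r <- [:: 0; 1; 2; 3; 4]%N].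

(* Each edge of T is listed in at least one of its two orientations. *)
Definition T_edge_list : seq (nat * nat) :=
  bipyramid ++ gadget_copy copy1 ++ gadget_copy copy2
    ++ [:: (6, 12); (6, 20)]%N.

Definition T : rel 'I_31 := fun x y =>
  ((nat_of_ord x, nat_of_ord y) \in T_edge_list)
  || ((nat_of_ord y, nat_of_ord x) \in T_edge_list).

(* Main.v *)
Require Import Defs.
From Stdlib Require Import ZArith.
From mathcomp Require Import all_boot all_order all_algebra.
From mathcomp Require Import boolp classical_sets functions set_interval.
From mathcomp Require Import reals prodnormedzmodule interval_inference.
From mathcomp Require Import topology normedtype.
From mathcomp Require Import ring lra zify ssrZ.
Set Implicit Arguments.
Unset Strict Implicit.
Unset Printing Implicit Defensive.
Import Order.TTheory GRing.Theory Num.Theory.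
Import numFieldNormedType.Exports.
Local Open Scope ring_scope.

(** Planarity is witnessed by an explicit straight-line drawing.

    Nonplanarity of T + xy needs no Jordan curve theorem.  Let [winding v f] be
    the parity of the number of times the vector f - v crosses the negative
    horizontal axis along an arc f, computed on a fine sampling of f.  If the
    arcs f (from x to y) and g (from u to v) are disjoint, then g(t) - f(s)
    never vanishes on the unit square, so it crosses that axis an even number
    of times along the boundary of the square; this is a linear relation
    modulo 2 between the windings of g around x, y, of f around u, v, and the
    half-planes containing x - u, x - v, y - u, y - v.  The relations extend
    from edges to walks by additivity.  For five vertices joined pairwise by
    walks such that walks without a common end are disjoint, the 15 relations
    add up to 1 = 0.  In T + xy the five vertices are x, y and three neighbours
    of x.

    For the forest number, every induced forest has at most 6 internal vertices
    in each copy of the gadget, at most 5 if it contains both terminals, and at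
    most 4 vertices in the bipyramid, at most 3 if it contains neither {0, 1}
    nor {2, 3}. *)

(** * Winding parity *)

(** A half-open half-plane, so that it contains exactly one of any two opposite nonzero vectors,
    also on the horizontal axis. *)
Definition upper (R : realDomainType) (p : R * R) : bool :=
  (0 < p.2) || (p.2 == 0) && (0 < p.1).

Lemma upperN (R : realDomainType) (p : R * R) :
  p != 0 -> upper (- p) = ~~ upper p.
Proof.
case: p => x y; rewrite /upper /= !oppr_gt0 oppr_eq0.
rewrite -[0]/(0, 0) xpair_eqE.
by case: (ltgtP y 0); case: (ltgtP x 0).
Qed.

Lemma upper_subC (R : realDomainType) (p q : R * R) :
  p != q -> upper (q - p) = ~~ upper (p - q).
Proof. by move=> ne; rewrite -opprB upperN // subr_eq0. Qed.

(* Meaningful only if p and q lie in a common open half-plane bounded by a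
   coordinate axis: then p.1 and q.1 have the same sign whenever the segment
   from p to q crosses the horizontal axis. *)
Definition crosses (R : realDomainType) (p q : R * R) : bool :=
  (upper p (+) upper q) && (p.1 < 0).

Definition in_side (R : realDomainType) (i s : bool) (p : R * R) : bool :=
  0 < (-1) ^+ s * (if i then p.1 else p.2).

(** In the left half-plane [crosses] is the sum modulo 2 of [upper] at the two ends; in the other
    three it vanishes. Either way it sums to zero around a quadrilateral. *)
Lemma crosses_cell (R : realDomainType) i s (p q r t : R * R) :
  in_side i s p -> in_side i s q -> in_side i s r -> in_side i s t ->
  crosses p q (+) crosses r t = crosses p r (+) crosses q t.
Proof.
rewrite /in_side /crosses /upper.
case: i; case: s => /=; rewrite ?expr0 ?expr1 ?mulN1r ?mul1r ?oppr_gt0.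
- by move=> -> -> -> _; rewrite !andbT; do 4![case: (_ || _)].
- move=> p0 q0 r0 _.
  by rewrite !(lt_gtF p0, lt_gtF q0, lt_gtF r0) !andbF.
- move=> p0 q0 r0 t0.
  by rewrite !(lt_gtF p0, lt_gtF q0, lt_gtF r0, lt_gtF t0,
               lt_eqF p0, lt_eqF q0, lt_eqF r0, lt_eqF t0).
- by move=> -> -> -> ->.
Qed.

(** Negation exchanges the two horizontal half-axes, and a change of [upper] is a crossing of
    exactly one of them. *)
Lemma crossesN (R : realDomainType) i s (p q : R * R) :
  in_side i s p -> in_side i s q ->
  crosses p q = crosses (- p) (- q) (+) (upper (- p) (+) upper (- q)).
Proof.
move=> p0 q0.
have nz (u : R * R) : in_side i s u -> u != 0.
  apply: contraTneq => ->; rewrite /in_side /=.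
  by case: i {p0 q0}; rewrite mulr0 ltxx.
rewrite /crosses !upperN ?(nz p) ?(nz q) //= oppr_lt0 addbN addNb negbK.
case: (ltgtP p.1 0) => [_|_|p1_0]; rewrite ?andbT ?andbF ?addbF ?addbb //.
move: p0 q0; rewrite /in_side /upper p1_0 ltxx {nz}; case: i.
  by rewrite mulr0 ltxx.
by case: s; rewrite ?expr0 ?expr1 ?mulN1r ?mul1r ?oppr_gt0 => p0 q0;
  rewrite ?p0 ?q0 ?(lt_gtF p0) ?(lt_gtF q0) ?(lt_eqF p0) ?(lt_eqF q0).
Qed.

Lemma parity_telescope (h : nat -> bool) n :
  \big[addb/false]_(i < n) (h i (+) h i.+1) = h 0%N (+) h n.
Proof.
elim: n => [|n IHn]; first by rewrite big_ord0 addbb.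
by rewrite big_ord_recr /= IHn; case: (h 0%N); case: (h n); case: (h n.+1).
Qed.

(** Discrete Stokes formula modulo 2: in the sum of the cell relations every interior edge of the
    grid occurs twice. *)
Lemma parity_grid (a b : nat -> nat -> bool) m n :
  (forall i j, (i < m)%N -> (j < n)%N ->
     a i j (+) a i j.+1 = b i j (+) b i.+1 j) ->
  \big[addb/false]_(i < m) (a i 0%N (+) a i n) =
  \big[addb/false]_(j < n) (b 0%N j (+) b m j).
Proof.
move=> cell.
transitivity (\big[addb/false]_(i < m) \big[addb/false]_(j < n)
    (b i j (+) b i.+1 j)).
  apply: eq_bigr => i _; rewrite -(parity_telescope (a i)).
  by apply: eq_bigr => j _; apply: cell.
rewrite exchange_big; apply: eq_bigr => j _.
exact: (parity_telescope (fun i => b i j)).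
Qed.

Definition sample (R : realType) (N k : nat) : R := k%:R / N.+1%:R.

Definition winding (R : realType) (v : R * R) (f : R -> R * R) (N : nat)
  : bool :=
  \big[addb/false]_(j < N.+1)
    crosses (f (sample R N j) - v) (f (sample R N j.+1) - v).

Lemma sample_itv (R : realType) N k :
  (k <= N.+1)%N -> sample R N k \in `[0, 1].
Proof.
move=> kN; rewrite in_itv /= /sample divr_ge0 ?ler0n //=.
by rewrite ler_pdivrMr ?ltr0n // mul1r ler_nat.
Qed.

(** The hypothesis puts the four corners of each grid cell in one half-plane, so [crosses_cell]
    applies to every cell. *)
Lemma winding_square (R : realType) (f g : R -> R * R) N :
  (forall s t : R, s \in `[0, 1] -> t \in `[0, 1] -> exists i s0,
     forall s' t', s' \in `[0, 1] -> t' \in `[0, 1] ->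
       `|s - s'| <= N.+1%:R^-1 -> `|t - t'| <= N.+1%:R^-1 ->
       in_side i s0 (g t' - f s')) ->
  winding (f 0) g N (+) winding (f 1) g N
  (+) winding (g 0) f N (+) winding (g 1) f N
  (+) upper (f 0 - g 0) (+) upper (f 1 - g 0)
  (+) upper (f 0 - g 1) (+) upper (f 1 - g 1) = false.
Proof.
move=> loc.
pose F i j := g (sample R N j) - f (sample R N i).
have s0 : sample R N 0 = 0 by rewrite /sample mul0r.
have s1 : sample R N N.+1 = 1 by rewrite /sample divff // pnatr_eq0.
have dist0 k : `|sample R N k - sample R N k| <= N.+1%:R^-1.
  by rewrite subrr normr0 invr_ge0.
have dist1 k : `|sample R N k - sample R N k.+1| <= N.+1%:R^-1.
  by rewrite /sample -mulrBl -natr1 opprD addNKr mulN1r normrN ger0_norm ?invr_ge0.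
have cell i j : (i < N.+1)%N -> (j < N.+1)%N -> exists a b,
    [/\ in_side a b (F i j), in_side a b (F i.+1 j),
        in_side a b (F i j.+1) & in_side a b (F i.+1 j.+1)].
  move=> iN jN.
  have [a [b ab]] := loc _ _ (sample_itv R (ltnW iN)) (sample_itv R (ltnW jN)).
  by exists a, b; split; apply: ab; rewrite ?sample_itv ?(ltnW iN) ?(ltnW jN).
have /parity_grid : forall i j, (i < N.+1)%N -> (j < N.+1)%N ->
    crosses (F i j) (F i.+1 j) (+) crosses (F i j.+1) (F i.+1 j.+1) =
    crosses (F i j) (F i j.+1) (+) crosses (F i.+1 j) (F i.+1 j.+1).
  move=> i j iN jN; have [a [b [? ? ? ?]]] := cell _ _ iN jN.
  exact: (@crosses_cell _ a b).
rewrite !big_split /=.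
(* On the two sides where [g] is fixed, the vectors are opposite to those in the winding of [f]; the
   corrections from [crossesN] telescope to the ends. *)
have flip k : (k = 0 \/ k = N.+1)%N ->
    \big[addb/false]_(i < N.+1) crosses (F i k) (F i.+1 k) =
    winding (g (sample R N k)) f N
    (+) (upper (f 0 - g (sample R N k)) (+) upper (f 1 - g (sample R N k))).
  move=> k0N; have -> : f 0 = f (sample R N 0) by rewrite s0.
  have -> : f 1 = f (sample R N N.+1) by rewrite s1.
  pose h i := upper (f (sample R N i) - g (sample R N k)).
  rewrite -[X in _ (+) X](parity_telescope h) -big_split /=.
  apply: eq_bigr => i _.
  have [a [b [ha hb]]] :
      exists a b, in_side a b (F i k) /\ in_side a b (F i.+1 k).
    case: k0N => ->.
      by have [a [b [? ? _ _]]] := cell i 0%N (ltn_ord i) isT; exists a, b.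
    by have [a [b [_ _ ? ?]]] := cell i N (ltn_ord i) (ltnSn _); exists a, b.
  by rewrite (crossesN ha hb) /h /F !opprB.
rewrite (flip 0%N) ?(flip N.+1); [|by right|by left].
rewrite s0 s1.
have -> : \big[addb/false]_(j < N.+1) crosses (F 0%N j) (F 0%N j.+1) =
          winding (f 0) g N by apply: eq_bigr => j _; rewrite /F s0.
have -> : \big[addb/false]_(j < N.+1) crosses (F N.+1 j) (F N.+1 j.+1) =
          winding (f 1) g N by apply: eq_bigr => j _; rewrite /F s1.
do 4![case: upper]; do 4![case: winding] => //.
Qed.

Lemma within_continuous_modulus (R : realType) (f : R -> R * R) (s e : R) :
  {within `[0, 1], continuous f}%classic -> s \in `[0, 1] -> 0 < e ->
  exists2 d, 0 < d & forall s', s' \in `[0, 1] -> `|s - s'| < d ->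
    `|f s - f s'| < e.
Proof.
move=> /subspace_continuousP cf sI e0.
have /cvgr_dist_lt /(_ _ e0) := cf s sI.
rewrite near_withinE => /nbhs_ballP [d /= d0 dP].
exists d => // s' s'I sd; exact: (dP s' sd s'I).
Qed.

(** Within the absolute value of a nonzero coordinate, in the maximum norm, that coordinate keeps
    its sign. *)
Lemma in_side_near (R : realType) (p : R * R) :
  p != 0 -> exists i s, exists2 e, 0 < e & forall q, `|p - q| < e ->
    in_side i s q.
Proof.
move=> p0.
have [i pi0] : exists i : bool, (if i then p.1 else p.2) != 0.
  case: p p0 => x y; rewrite -[0]/(0, 0) xpair_eqE negb_and => /orP[] ?.
    by exists true.
  by exists false.
pose s := (if i then p.1 else p.2) < 0.
exists i, s, `|if i then p.1 else p.2|; first by rewrite normr_gt0.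
move=> q; rewrite prod_normE /= gt_max => /andP[q1 q2].
have {q1 q2} : `|(if i then p.1 else p.2) - (if i then q.1 else q.2)| <
    `|if i then p.1 else p.2| by case: (i) q1 q2.
rewrite /in_side /s; move: (if i then p.1 else p.2) (if i then q.1 else q.2) pi0.
move=> x y; case: (ltrgt0P x) => // x0 _; rewrite ?expr0 ?expr1 ?mul1r ?mulN1r.
  by rewrite ltr_norml; lra.
by rewrite ltr_norml; lra.
Qed.

(** [g t - f s] never vanishes, so locally it stays in one half-plane; compactness of the unit
    square gives one mesh that is fine enough everywhere. *)
Lemma disjoint_arcs_in_side (R : realType) (f g : R -> R * R) :
  {within `[0, 1], continuous f}%classic ->
  {within `[0, 1], continuous g}%classic ->
  (forall s t, s \in `[0, 1] -> t \in `[0, 1] -> f s != g t) ->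
  \forall N \near \oo%classic, forall s t : R, s \in `[0, 1] -> t \in `[0, 1] ->
    exists i s0, forall s' t', s' \in `[0, 1] -> t' \in `[0, 1] ->
       `|s - s'| <= N.+1%:R^-1 -> `|t - t'| <= N.+1%:R^-1 ->
       in_side i s0 (g t' - f s').
Proof.
move=> cf cg fg.
have cI : compact (`[(0 : R), 1] : set R)%classic by exact: segment_compact.
have /compact_near_coveringP cov := compact_setX cI cI.
pose P (N : nat) (st : R * R) := exists i s0, forall s' t' : R,
  s' \in `[0, 1] -> t' \in `[0, 1] ->
  `|st.1 - s'| <= N.+1%:R^-1 -> `|st.2 - t'| <= N.+1%:R^-1 ->
       in_side i s0 (g t' - f s').
suff H : forall x : R * R, (`[0, 1] `*` `[0, 1])%classic x ->
    (\forall x' \near x & N \near \oo, P N x')%classic.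
  move: (cov _ (\oo)%classic P eventually_filter H); apply: filterS => N PN s t sI tI.
  exact: (PN (s, t) (conj sI tI)).
move=> [s t] [/= sI tI].
have [i [s0 [e e0 near_st]]] : exists i s0, exists2 e, 0 < e &
    forall q, `|(g t - f s) - q| < e -> in_side i s0 q.
  by apply: in_side_near; rewrite subr_eq0 eq_sym fg.
have e2 : 0 < e / 2 by rewrite divr_gt0.
have [d d0 df] := within_continuous_modulus cf sI e2.
have [d' d'0 dg] := within_continuous_modulus cg tI e2.
(* Half of the modulus is spent on moving from [(s, t)] to a nearby [x], the other half on a mesh
   step from [x]. *)
pose r := Num.min d d' / 2.
have r0 : 0 < r by rewrite divr_gt0 // lt_min d0.
near=> x N.
exists i, s0 => s' t' s'I t'I /= xs' xt'.
have Nr : N.+1%:R^-1 < r.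
  by near: N; exact: (near_infty_natSinv_lt (PosNum r0)).
have /andP[xs xt] : (`|s - x.1| < r) && (`|t - x.2| < r).
  near: x; apply/nbhs_ballP; exists r => //= y [/= ? ?]; exact/andP.
have close (u v w : R) : `|u - v| < r -> `|v - w| <= N.+1%:R^-1 ->
    `|u - w| < Num.min d d'.
  move=> uv vw; rewrite -(subrKA v) (le_lt_trans (ler_normD _ _)) //.
  have : `|u - v| + `|v - w| < r + r by apply: ltrD => //; apply: le_lt_trans Nr.
  by rewrite /r -splitr.
have /andP[sd _] : (`|s - s'| < d) && (`|s - s'| < d').
  by rewrite -lt_min; apply: close xs xs'.
have /andP[_ td] : (`|t - t'| < d) && (`|t - t'| < d').
  by rewrite -lt_min; apply: close xt xt'.
apply: near_st.
rewrite opprD addrACA -(opprD (f s)) [e]splitr.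
by rewrite (le_lt_trans (ler_normB _ _)) // ltrD ?dg ?df.
Unshelve. all: by end_near.
Qed.

(** * Nonplanarity from K5 *)

(** All that is kept of the topology: [W x u v] is the winding of the arc [uv] around [x], and
    [h x y] is [upper] of [pos x - pos y]. *)
Lemma planar_parity (R : realType) (V : finType) (e : rel V) :
  planar R e -> exists (W : V -> V -> V -> bool) (h : V -> V -> bool),
    (forall x y, x != y -> h y x = ~~ h x y) /\
    (forall x y u v, e x y -> e u v -> ~~ has [in [:: u; v]] [:: x; y] ->
       W x u v (+) W y u v (+) W u x y (+) W v x y
       (+) h x u (+) h y u (+) h x v (+) h y v = false).
Proof.
move=> [pos [arc [pos_inj arcP _ disj]]].
have /choice[f fP] (xy : V * V) : exists f : R -> R * R, e xy.1 xy.2 ->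
    [/\ {within `[0, 1], continuous f}%classic, f 0 = pos xy.1,
        f 1 = pos xy.2 & (f @` `[0, 1] = arc [set xy.1; xy.2]%SET)%classic].
  have [exy|_] := boolP (e xy.1 xy.2); last by exists (fun=> 0).
  by have [f [cf _ f0 f1 fA]] := arcP _ _ exy; exists f.
(* There are finitely many pairs of edges, so one [N] is fine enough for all of them. *)
have /filter_ex[N NP] : (\forall N \near \oo%classic, forall q : V * V * (V * V),
    e q.1.1 q.1.2 -> e q.2.1 q.2.2 ->
    ~~ has [in [:: q.2.1; q.2.2]] [:: q.1.1; q.1.2] ->
    winding (f q.1 0) (f q.2) N (+) winding (f q.1 1) (f q.2) N
    (+) winding (f q.2 0) (f q.1) N (+) winding (f q.2 1) (f q.1) N
    (+) upper (f q.1 0 - f q.2 0) (+) upper (f q.1 1 - f q.2 0)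
    (+) upper (f q.1 0 - f q.2 1) (+) upper (f q.1 1 - f q.2 1)
    = false).
  apply: filter_forall => -[[x y] [u v]] /=.
  have [exy|/negP nexy] := boolP (e x y); last exact: nearW.
  have [euv|/negP neuv] := boolP (e u v); last exact: nearW.
  have [dis|/negP ndis] := boolP (~~ has [in [:: u; v]] [:: x; y]);
    last exact: nearW.
  have [cf _ _ fA] := fP (x, y) exy; have [cg _ _ gA] := fP (u, v) euv.
  have fg s t : s \in `[0, 1] -> t \in `[0, 1] -> f (x, y) s != f (u, v) t.
    move=> sI tI; apply/eqP => fgst.
    have xE : [set x; y]%SET \in edges e by apply/imsetP; exists (x, y); rewrite ?inE.
    have uE : [set u; v]%SET \in edges e by apply/imsetP; exists (u, v); rewrite ?inE.
    have xyuv : [set x; y]%SET != [set u; v]%SET.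
      apply: contraNneq dis => xyuv; have : x \in [set u; v]%SET.
        by rewrite -xyuv !inE eqxx.
      by rewrite /= !inE => ->.
    have p1 : arc [set x; y]%SET (f (x, y) s) by rewrite -fA; exists s.
    have p2 : arc [set u; v]%SET (f (x, y) s) by rewrite fgst -gA; exists t.
    have [z] := disj _ _ xE uE xyuv _ p1 p2.
    rewrite inE => /andP[zxy zuv] _; move/hasPn: dis => /(_ z).
    by rewrite !inE in zxy zuv *; rewrite zuv zxy => /(_ isT).
  move: (disjoint_arcs_in_side cf cg fg); apply: filterS => N locN _ _ _.
  exact: winding_square.
exists (fun x u v => winding (pos x) (f (u, v)) N).
exists (fun x y => upper (pos x - pos y)).
split=> [x y xy|x y u v exy euv dis].
  by apply: upper_subC; rewrite (inj_eq pos_inj).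
have [_ f0 f1 _] := fP (x, y) exy; have [_ g0 g1 _] := fP (u, v) euv.
by have := NP ((x, y), (u, v)) exy euv dis; rewrite f0 f1 g0 g1.
Qed.

Fixpoint walk_parity (V : Type) (W : V -> V -> bool) (x : V) (s : seq V) :=
  if s is y :: s' then W x y (+) walk_parity W y s' else false.

(* With t the sum of the terms common to a and b, the last hypothesis is an
   identity of commutative rings. *)
Lemma addb_combine (t a b c : bool) :
  a = false -> b = false -> a (+) b = c (+) (t (+) t) -> c = false.
Proof. by move=> -> ->; case: t; case: c. Qed.

(** The terms at an intermediate vertex of a walk occur twice and cancel. The second walk is
    extended first, against a single edge, and then the first walk. *)
Lemma walk_square (V : eqType) (e : rel V) (W : V -> V -> V -> bool)
    (h : V -> V -> bool) :
  (forall x y u v, e x y -> e u v -> ~~ has [in [:: u; v]] [:: x; y] ->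
     W x u v (+) W y u v (+) W u x y (+) W v x y
     (+) h x u (+) h y u (+) h x v (+) h y v = false) ->
  forall x s u t, path e x s -> path e u t -> ~~ has [in u :: t] (x :: s) ->
  let y := last x s in let v := last u t in
  walk_parity (W x) u t (+) walk_parity (W y) u t
  (+) walk_parity (W u) x s (+) walk_parity (W v) x s
  (+) h x u (+) h y u (+) h x v (+) h y v = false.
Proof.
move=> square.
have edge_walk x y u t : e x y -> path e u t -> ~~ has [in u :: t] [:: x; y] ->
    let v := last u t in
    walk_parity (W x) u t (+) walk_parity (W y) u t (+) W u x y (+) W v x y
    (+) h x u (+) h y u (+) h x v (+) h y v = false.
  move=> exy; elim: t u => [|w t IHt] u /=.
    by move=> _ _; case: (W u x y); case: (h x u); case: (h y u).
  move=> /andP[euw wt] dis.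
  have dw : ~~ has [in w :: t] [:: x; y].
    by apply: contra dis; rewrite /= !inE; case/or3P => // ->; rewrite !orbT.
  have duw : ~~ has [in [:: u; w]] [:: x; y].
    apply: contra dis; rewrite /= !inE !orbF.
    by case/orP=> /orP[] ->; rewrite ?orbT.
  apply: (@addb_combine (W w x y (+) h x w (+) h y w) _ _ _
    (square x y u w exy euw duw) (IHt w wt dw)).
  by change addb with (@GRing.add bool); ring.
move=> x s u t; elim: s x => [|y s IHs] x /=.
  by move=> _ _ _; case: walk_parity; case: (h x u); case: (h x _).
move=> /andP[exy ys] ut dis.
have dxy : ~~ has [in u :: t] [:: x; y].
  by apply: contra dis => /= /or3P[->|->|] //; rewrite ?orbT.
have dys : ~~ has [in u :: t] (y :: s).
  by apply: contra dis => /= ->; rewrite orbT.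
apply: (@addb_combine (walk_parity (W y) u t (+) h y u (+) h y (last u t)) _ _ _
  (edge_walk x y u t exy ut dxy) (IHs y ys ut dys)).
by change addb with (@GRing.add bool); ring.
Qed.

(** Turns cancellation between unknown bits into a computation of multiplicities of their labels. *)
Lemma parity_even (I : eqType) (F : I -> bool) (s : seq I) :
  all (fun i => ~~ odd (count_mem i s)) s ->
  \big[addb/false]_(i <- s) F i = false.
Proof.
move=> /allP even_s; rewrite -big_undup_iterop_count big_seq big1 // => i.
rewrite mem_undup => /even_s.
have iterE n : iterop n addb (F i) false = odd n && F i.
  by rewrite Monoid.iteropE; elim: n => //= n ->; case: odd; case: (F i).
by rewrite iterE => /negbTE ->.
Qed.

(** Over the 15 pairs of disjoint edges of K5, each winding occurs twice and each unordered pair of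
    vertices gives six values of [h]; only the orientations of the latter survive. *)
Lemma K5_nonplanar (R : realType) (V : finType) (e : rel V) (b : nat -> V)
    (P : nat -> nat -> seq V) :
  (forall i j, (i < j < 5)%N ->
     [/\ path e (b i) (P i j), last (b i) (P i j) = b j & b i != b j]) ->
  (forall i j k l, (i < j < 5)%N -> (k < l < 5)%N -> (i < k)%N ->
     uniq [:: i; j; k; l] -> ~~ has [in b k :: P k l] (b i :: P i j)) ->
  ~ planar R e.
Proof.
move=> walkP disj /planar_parity[W [h [hC square]]].
have {}square := walk_square square.
(* Formal labels of the terms: [(k, (i, j))] with [i < j] is a winding around [b k], and the
   diagonal label [(k, (i, i))] stands for [h (b k) (b i)]. *)
pose F (t : nat * (nat * nat)) : bool :=
  let: (k, (i, j)) := t in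
  if i == j then h (b k) (b i) else walk_parity (W (b k)) (b i) (P i j).
pose quad (q : nat * nat * (nat * nat)) := let: ((i, j), (k, l)) := q in
  [:: (i, (k, l)); (j, (k, l)); (k, (i, j)); (l, (i, j));
      (i, (k, k)); (j, (k, k)); (i, (l, l)); (j, (l, l))].
pose idx := iota 0 5.
pose pairs := [seq ij <- [seq (i, j) | i <- idx, j <- idx] | (ij.1 < ij.2)%N].
pose quads := [seq q <- [seq (x, y) | x <- pairs, y <- pairs] |
  (q.1.1 < q.2.1)%N && uniq [:: q.1.1; q.1.2; q.2.1; q.2.2]].
have quadsP : all (fun q => [&& q.1.1 < q.1.2 < 5, q.2.1 < q.2.2 < 5,
    q.1.1 < q.2.1 & uniq [:: q.1.1; q.1.2; q.2.1; q.2.2]]%N) quads by vm_compute.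
have sum_quads : \big[addb/false]_(t <- flatten (map quad quads)) F t = false.
  rewrite big_flatten big_map big_seq big1 // => -[[i j] [k l]].
  case/(allP quadsP)/and4P => /= ij kl ik ijkl.
  have [pij lij _] := walkP _ _ ij; have [pkl lkl _] := walkP _ _ kl.
  have /= := square _ _ _ _ pij pkl (disj _ _ _ _ ij kl ik ijkl).
  rewrite lij lkl !big_cons big_nil addbF /= !eqxx.
  case/andP: ij => ij _; case/andP: kl => kl _.
  by rewrite (ltn_eqF ij) (ltn_eqF kl) !addbA.
(* A value of [h] with decreasing indices is replaced by the negation of the reversed one. *)
pose flip (t : nat * (nat * nat)) := (t.2.1 == t.2.2) && (t.2.1 < t.1 < 5)%N.
pose norm (t : nat * (nat * nat)) :=
  if flip t then (t.2.1, (t.1, t.1)) else t.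
have normE t : F t = flip t (+) F (norm t).
  rewrite /norm; case: ifP => // /andP[].
  case: t => k [i j] /= /eqP <- ik; rewrite !eqxx /=.
  by rewrite hC; have [] := walkP _ _ ik.
(* Normalized labels have even multiplicities, which leaves the number of flips. The three
   splittings of four vertices into pairs need 0, 1 and 2 flips, so the five quadruples give 15,
   which is odd. *)
move: sum_quads; rewrite (eq_bigr _ (fun t _ => normE t)) big_split /=.
rewrite -(big_map norm predT F) (parity_even F); last by vm_compute.
by rewrite addbF unlock; vm_compute.
Qed.

(** * Straight-line drawings *)

(** Twice the signed area of the triangle [pqr]; its sign tells on which side of the line [pq] the
    point [r] lies. *)
Definition det3 (R : comRingType) (p q r : R * R) : R :=
  (q.1 - p.1) * (r.2 - p.2) - (q.2 - p.2) * (r.1 - p.1).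

Definition segment_point (R : comRingType) (p q : R * R) (t : R) : R * R :=
  (p.1 + t * (q.1 - p.1), p.2 + t * (q.2 - p.2)).

Lemma segment_point0 (R : comRingType) (p q : R * R) : segment_point p q 0 = p.
Proof. by case: p => a b; rewrite /segment_point !mul0r !addr0. Qed.

Lemma segment_point1 (R : comRingType) (p q : R * R) : segment_point p q 1 = q.
Proof. by case: q => a b; rewrite /segment_point !mul1r ![_ + (_ - _)]addrC !subrK. Qed.

Lemma segment_point_rev (R : comRingType) (p q : R * R) t :
  segment_point p q t = segment_point q p (1 - t).
Proof. by rewrite /segment_point; congr (_, _); ring. Qed.

Lemma det3_segment (R : comRingType) (p q u v : R * R) t :
  det3 p q (segment_point u v t) = (1 - t) * det3 p q u + t * det3 p q v.
Proof. by rewrite /det3 /=; ring. Qed.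

Lemma det3_xyx (R : comRingType) (p q : R * R) : det3 p q p = 0.
Proof. by rewrite /det3; ring. Qed.

Lemma det3_xyy (R : comRingType) (p q : R * R) : det3 p q q = 0.
Proof. by rewrite /det3; ring. Qed.

Lemma same_side_segment (R : realDomainType) (p q u v : R * R) (t : R) :
  t \in `[0, 1] -> 0 < det3 p q u * det3 p q v ->
  det3 p q (segment_point u v t) != 0.
Proof.
rewrite in_itv /= => /andP[t0 t1]; rewrite det3_segment.
move: (det3 p q u) (det3 p q v) => a b ab; apply/eqP => ab0.
(* Multiplying the supposed zero by [a] and by [b] gives [t * (a * b) <= 0] and
   [(1 - t) * (a * b) <= 0], whose sum contradicts [ab]. *)
have : 0 <= (1 - t) * a ^+ 2 by rewrite mulr_ge0 ?subr_ge0 ?sqr_ge0.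
have : 0 <= t * b ^+ 2 by rewrite mulr_ge0 ?sqr_ge0.
have : a * ((1 - t) * a + t * b) = 0 by rewrite ab0 mulr0.
have : b * ((1 - t) * a + t * b) = 0 by rewrite ab0 mulr0.
lra.
Qed.

Lemma continuous_segment_point (R : realType) (p q : R * R) :
  continuous (segment_point p q).
Proof.
move=> t.
have affine (a b : R) : ((fun t => a + t * b) @ t --> a + t * b)%classic.
  apply: cvgD; first exact: cvg_cst.
  by apply: cvgM; [exact: cvg_id|exact: cvg_cst].
exact: (cvg_pair (affine p.1 (q.1 - p.1)) (affine p.2 (q.2 - p.2))).
Qed.

Lemma segment_point_inj (R : idomainType) (p q : R * R) :
  p != q -> injective (segment_point p q).
Proof.
case: p q => p1 p2 [q1 q2]; rewrite xpair_eqE negb_and => pq s t [].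
move=> /addrI e1 /addrI e2; case/orP: pq => ne; [move: e1|move: e2].
  by apply: mulIf; rewrite subr_eq0 eq_sym.
by apply: mulIf; rewrite subr_eq0 eq_sym.
Qed.

Lemma set2_eq (T : finType) (x y u v : T) :
  u != v -> [set x; y]%SET = [set u; v]%SET ->
  (u = x /\ v = y) \/ (u = y /\ v = x).
Proof.
move=> uv xyuv.
have : u \in [set x; y]%SET by rewrite xyuv !inE eqxx.
have : v \in [set x; y]%SET by rewrite xyuv !inE eqxx orbT.
rewrite !inE => /orP[]/eqP vE /orP[]/eqP uE; subst u v; rewrite ?eqxx in uv *;
  by [left|right|].
Qed.

(** Disjoint edges do not meet because the line of one has both ends of the other strictly on one
    side; general position handles edges with a common end. *)
Lemma straight_line_planar (R : realType) (V : finType) (e r : rel V)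
    (pos : V -> R * R) :
  (forall x y, e x y -> r x y || r y x) -> irreflexive r -> injective pos ->
  (forall x y z, r x y -> z \notin [:: x; y] ->
     det3 (pos x) (pos y) (pos z) != 0) ->
  (forall x y u v, r x y -> r u v -> ~~ has [in [:: u; v]] [:: x; y] ->
     (0 < det3 (pos x) (pos y) (pos u) * det3 (pos x) (pos y) (pos v)) ||
     (0 < det3 (pos u) (pos v) (pos x) * det3 (pos u) (pos v) (pos y))) ->
  planar R e.
Proof.
move=> e_r irr pos_inj gen sep.
have neq x y : r x y -> x != y by apply: contraTneq => ->; rewrite irr.
exists pos, (fun E => [set p | exists x y t, [/\ E = [set x; y]%SET, r x y,
  t \in `[0, 1]%R & p = segment_point (pos x) (pos y) t]]%classic).
have rev_itv (t : R) : t \in `[0, 1] -> 1 - t \in `[0, 1].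
  by rewrite !in_itv /= => /andP[? ?]; apply/andP; split; lra.
split=> //.
- move=> x y /e_r exy; exists (segment_point (pos x) (pos y)).
  split; rewrite ?segment_point0 ?segment_point1 //.
  + by apply: continuous_subspaceT; exact: continuous_segment_point.
  + move=> s t _ _; apply: segment_point_inj; rewrite (inj_eq pos_inj).
    by case/orP: exy => /neq //; rewrite eq_sym.
  + apply/seteqP; split=> [_ [t tI <-]|_ [u [v [t [uvE euv tI ->]]]]].
      case/orP: exy => [exy|eyx]; first by exists x, y, t; split.
      exists y, x, (1 - t); split=> //; first exact: finset.setUC.
        exact: rev_itv.
      exact: segment_point_rev.
    have [[-> ->]|[-> ->]] := set2_eq (neq _ _ euv) uvE; first by exists t.
    exists (1 - t); last by rewrite -segment_point_rev.
    exact: rev_itv.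
- move=> E z _ [x [y [t [-> exy tI zE]]]]; apply: contraT => zxy.
  have := gen x y z exy; rewrite zE det3_segment det3_xyx det3_xyy !mulr0 addr0.
  by rewrite eqxx; apply; rewrite !inE in zxy *.
- move=> E E' _ _ EE' p [x [y [t [E_ exy tI pE]]]] [u [v [s [E'_ euv sI pE']]]].
  subst E E'.
  have on_xy : det3 (pos x) (pos y) p = 0.
    by rewrite pE det3_segment det3_xyx det3_xyy !mulr0 addr0.
  have on_uv : det3 (pos u) (pos v) p = 0.
    by rewrite pE' det3_segment det3_xyx det3_xyy !mulr0 addr0.
  (* On the segment from an end [z] of the edge [xy] to a vertex [w] off its line, the determinant
     is [t'] times a nonzero number, so the line is met only at [z]. *)
  have at_end z w t' : z \in [:: x; y] -> w \notin [:: x; y] ->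
      p = segment_point (pos z) (pos w) t' -> p = pos z.
    move=> zxy wxy pz; move: on_xy (gen x y w exy wxy); rewrite {1}pz det3_segment.
    have -> : det3 (pos x) (pos y) (pos z) = 0.
      by move: zxy; rewrite !inE => /orP[] /eqP ->; rewrite ?det3_xyx ?det3_xyy.
    rewrite mulr0 add0r => /eqP; rewrite mulf_eq0 => /orP[/eqP t0|/eqP-> /eqP //].
    by move=> _; rewrite pz t0 segment_point0.
  have mem2 z : (z \in [set x; y]%SET) = (z \in [:: x; y]) by rewrite !inE.
  have [uxy|uxy] := boolP (u \in [:: x; y]); have [vxy|vxy] := boolP (v \in [:: x; y]).
  + case/negP: EE'; rewrite eq_sym eqEcard finset.subUset !finset.sub1set !mem2 uxy vxy.
    by rewrite !cards2 neq // neq.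
  + exists u; last exact: at_end vxy pE'.
    by rewrite inE mem2 uxy !inE eqxx.
  + exists v; last by apply: at_end vxy uxy _; rewrite pE' segment_point_rev.
    by rewrite inE mem2 vxy !inE eqxx orbT.
  + have dis : ~~ has [in [:: u; v]] [:: x; y].
      move: uxy vxy; rewrite /= !inE !negb_or ![u == _]eq_sym ![v == _]eq_sym.
      by move=> /andP[-> ->] /andP[-> ->].
    case/orP: (sep x y u v exy euv dis) => [/(same_side_segment sI)|].
      by rewrite -pE' on_xy eqxx.
    by move=> /(same_side_segment tI); rewrite -pE on_uv eqxx.
Qed.

(** * Induced forests and edge counts *)

(* No set with at least m elements in vs avoids all the members of C: each
   element of vs is put in or out of the set, and C keeps what remains of the
   members that can still be contained in the set. *)
Fixpoint hits_all (C : seq (seq nat)) (vs : seq nat) (m : nat) : bool :=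
  [|| [::] \in C, (size vs < m)%N |
    if vs is v :: vs' then
      hits_all (map (rem v) C) vs' m.-1
      && hits_all [seq c <- C | v \notin c] vs' m
    else false].

Lemma hits_allP C vs m (F : pred nat) :
  hits_all C vs m -> (forall c, c \in C -> ~~ all F c) -> (count F vs < m)%N.
Proof.
have base (C' : seq (seq nat)) vs' m' : ([::] \in C') || (size vs' < m')%N ->
    (forall c, c \in C' -> ~~ all F c) -> (count F vs' < m')%N.
  case/orP=> [C0 /(_ _ C0) //|lt_m _].
  by rewrite (leq_ltn_trans (count_size _ _)).
elim: vs C m => [|v vs IHvs] C m /=; first by rewrite orbF; exact: (base C [::]).
rewrite orbA => /orP[|/andP[inC outC] avoid]; first exact: (base C (v :: vs)).
have [Fv|Fv] := boolP (F v); last first.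
  by rewrite add0n; apply: IHvs outC _ => c; rewrite mem_filter => /andP[_ /avoid].
have : (count F vs < m.-1)%N.
  apply: IHvs inC _ => _ /mapP[c cC ->]; apply: contra (avoid c cC) => Fc.
  have [vc|vc] := boolP (v \in c); last by rewrite -(rem_id vc).
  by rewrite (perm_all _ (perm_to_rem vc)) /= Fv.
by case: m {inC outC} => //= m; rewrite add1n ltnS.
Qed.

(** The vertex of a cycle that comes first in [s] has both its neighbours on the cycle later in [s],
    one more than allowed. *)
Lemma elimination_forest (V : finType) (e : rel V) (s : seq V) :
  symmetric e ->
  (forall s1 x s2, s = s1 ++ x :: s2 -> (count (e x) s2 <= 1)%N) ->
  induces_forest e [set x in s].
Proof.
move=> eC elim_s c c_s c3 [cyc_c uniq_c].
have {c_s} c_s : {subset c <= s} by move=> x /c_s; rewrite inE.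
elim: s elim_s c_s => [|x s IHs] elim_s c_s.
  by case: c c_s c3 {cyc_c uniq_c} => // y c /(_ y); rewrite !inE eqxx => /(_ isT).
have [xc|xc] := boolP (x \in c); last first.
  apply: IHs => [s1 y s2 s_eq|y yc]; first by apply: (elim_s (x :: s1)); rewrite s_eq.
  by have := c_s y yc; rewrite inE => /orP[/eqP yx|//]; rewrite -yx yc in xc.
have [i c' rot_c] := rot_to xc.
have : (2 < size (x :: c'))%N by rewrite -rot_c size_rot.
have : cycle e (x :: c') by rewrite -rot_c rot_cycle.
have : uniq (x :: c') by rewrite -rot_c rot_uniq.
have c'_s y : y \in c' -> y \in x :: s.
  by move=> yc'; apply: c_s; rewrite -(mem_rot i) rot_c inE yc' orbT.
case: c' {rot_c} c'_s => [//|y c'].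
case/lastP: c' => [//|c' z] c'_s /=; rewrite rcons_path last_rcons.
rewrite !inE !mem_rcons !inE !negb_or.
move=> /andP[/andP[xy /andP[xz xc']] /andP[/andP[yz _] _]] /andP[exy /andP[_ ezx]] _.
have : (size [:: y; z] <= size [seq v <- s | e x v])%N.
  apply: uniq_leq_size; first by rewrite /= inE yz.
  move=> v; rewrite !inE mem_filter => /orP[]/eqP->.
    by have := c'_s y (mem_head _ _); rewrite inE eq_sym (negbTE xy) exy.
  have := c'_s z; rewrite inE mem_rcons mem_head orbT => /(_ isT).
  by rewrite inE eq_sym (negbTE xz) eC ezx.
by rewrite size_filter leqNgt ltnS (elim_s [::]).
Qed.

Lemma card_edges (n : nat) (e : rel 'I_n) :
  symmetric e -> irreflexive e ->
  #|edges e| = #|[set u : 'I_n * 'I_n | (u.1 < u.2)%N && e u.1 u.2]%SET|.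
Proof.
move=> eC irr; rewrite -[RHS](card_in_imset (f := fun u => [set u.1; u.2]%SET)).
  congr #|pred_of_set _|; apply/setP => E; apply/imsetP/imsetP => -[[x y]].
    rewrite inE /= => exy ->; case: (ltngtP x y) => [xy|yx|/val_inj xy].
    - by exists (x, y); rewrite ?inE ?xy.
    - by exists (y, x); rewrite ?inE /= ?yx 1?eC // finset.setUC.
    - by rewrite xy irr in exy.
  by rewrite inE => /andP[_ exy] ->; exists (x, y); rewrite ?inE.
move=> [x y] [u v]; rewrite !inE /= => /andP[xy _] /andP[uv _] E.
have [|[-> ->] //|[ux vy]] := set2_eq _ E.
  by apply: contraTneq uv => ->; rewrite ltnn.
by move: uv; rewrite ux vy ltnNge ltnW.
Qed.

(** * The graph T *)

Local Open Scope nat_scope.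

(** Adjacency lists keep the computations on natural numbers; [T_adjn] checks them against
    [T_edge_list]. *)
Definition T_nbrs : seq (seq nat) := [::
    [:: 1; 4; 5; 6; 7; 8; 12]; [:: 0; 2; 5; 6; 8; 12; 13];
    [:: 1; 3; 5; 6; 19; 20; 24]; [:: 2; 4; 5; 6; 20; 24; 25]; [:: 0; 3; 5; 6];
    [:: 0; 1; 2; 3; 4]; [:: 0; 1; 2; 3; 4; 12; 20]; [:: 0; 8; 9; 10; 11; 12];
    [:: 0; 1; 7; 9; 13; 14]; [:: 7; 8; 10; 14; 15]; [:: 7; 9; 11; 15; 16];
    [:: 7; 10; 12; 16; 17]; [:: 0; 1; 6; 7; 11; 13; 17];
    [:: 1; 8; 12; 14; 17; 18]; [:: 8; 9; 13; 15; 18]; [:: 9; 10; 14; 16; 18];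
    [:: 10; 11; 15; 17; 18]; [:: 11; 12; 13; 16; 18]; [:: 13; 14; 15; 16; 17];
    [:: 2; 20; 21; 22; 23; 24]; [:: 2; 3; 6; 19; 21; 25; 26];
    [:: 19; 20; 22; 26; 27]; [:: 19; 21; 23; 27; 28]; [:: 19; 22; 24; 28; 29];
    [:: 2; 3; 19; 23; 25; 29]; [:: 3; 20; 24; 26; 29; 30];
    [:: 20; 21; 25; 27; 30]; [:: 21; 22; 26; 28; 30]; [:: 22; 23; 27; 29; 30];
    [:: 23; 24; 25; 28; 30]; [:: 25; 26; 27; 28; 29]].

Lemma all_iota n (p : pred nat) : all p (iota 0 n) -> forall x, (x < n) -> p x.
Proof. by move=> /allP p_n x xn; apply: p_n; rewrite mem_iota. Qed.

Definition adjn (u v : nat) : bool := v \in nth [::] T_nbrs u.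

Lemma T_adjn (x y : 'I_31) : T x y = adjn x y.
Proof.
have ok : all (fun u => all (fun v =>
    adjn u v == ((u, v) \in T_edge_list) || ((v, u) \in T_edge_list))
    (iota 0 31)) (iota 0 31) by vm_compute.
by rewrite /T (eqP (all_iota (all_iota ok (ltn_ord x)) (ltn_ord y))).
Qed.

Lemma T_sym : symmetric T.
Proof. by move=> x y; rewrite /T orbC. Qed.

Lemma T_irr : irreflexive T.
Proof.
have ok : all (fun u => ~~ adjn u u) (iota 0 31) by vm_compute.
by move=> x; rewrite T_adjn (negbTE (all_iota ok (ltn_ord x))).
Qed.

Lemma T_degree (x : 'I_31) : degree T x = size (nth [::] T_nbrs x).
Proof.
rewrite /degree cardsE -sum1_card (eq_bigl (fun y : 'I_31 => adjn x y)); last first.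
  exact: T_adjn.
rewrite -(big_mkord (adjn x) (fun=> 1)) sum1_count.
have ok : all (fun u => count (adjn u) (iota 0 31) == size (nth [::] T_nbrs u))
  (iota 0 31) by vm_compute.
by rewrite /index_iota subn0 (eqP (all_iota ok (ltn_ord x))).
Qed.

Lemma T_degree_sequence : perm_eq [seq degree T x | x : 'I_31]
  (nseq 1 4 ++ nseq 17 5 ++ nseq 6 6 ++ nseq 7 7).
Proof.
rewrite /image_mem (eq_map T_degree).
rewrite (map_comp (fun u => size (nth [::] T_nbrs u)) val) val_enum_ord.
by vm_compute.
Qed.

Lemma T_edge_count : #|edges T| = 87.
Proof.
rewrite card_edges; [|exact: T_sym|exact: T_irr].
rewrite cardsE -sum1_card.
rewrite -(pair_big_dep predT (fun x y : 'I_31 => (x < y) && T x y) (fun _ _ => 1)) /=.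
transitivity (\sum_(x < 31) count (fun v => (x < v) && adjn x v) (iota 0 31)).
  apply: eq_bigr => x _.
  rewrite -[iota 0 31]/(index_iota 0 31) -sum1_count big_mkord.
  by apply: eq_bigl => y; rewrite T_adjn.
rewrite -(big_mkord predT (fun u => count (fun v => (u < v) && adjn u v) (iota 0 31))).
by rewrite unlock; vm_compute.
Qed.

Lemma path_inord (r : rel nat) (e : rel 'I_31) u s :
  {in gtn 31 &, forall v w, r v w -> e (inord v) (inord w)} ->
  all (gtn 31) (u :: s) -> path r u s -> path e (inord u) (map inord s).
Proof.
move=> re; elim: s u => //= v s IHs u /and3P[u31 v31 s31] /andP[ruv rvs].
by rewrite re //= IHs //= v31.
Qed.

Lemma adjn_inord : {in gtn 31 &, forall v w,
  adjn v w -> T (inord v) (inord w)}.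
Proof. by move=> v w v31 w31 vw; rewrite T_adjn !inordK. Qed.

Lemma inord_inj : {in gtn 31 &, injective (@inord 30)}.
Proof. by move=> u v u31 v31 /(congr1 (@nat_of_ord 31)); rewrite !inordK. Qed.

(** * Induced forests of [T] *)

(** Cycles of the first copy of the gadget, with terminals 0 and 1. Any 7 internal vertices, and any
    8 vertices of the copy, contain all vertices of one of them. *)
Definition gadget_cycles : seq (seq nat) := [::
    [:: 0; 1; 8]; [:: 0; 1; 12]; [:: 7; 8; 9]; [:: 7; 9; 10]; [:: 7; 10; 11];
    [:: 7; 11; 12]; [:: 8; 9; 14]; [:: 8; 13; 14]; [:: 9; 10; 15];
    [:: 9; 14; 15]; [:: 16; 10; 11]; [:: 16; 10; 15]; [:: 16; 11; 17];
    [:: 16; 15; 18]; [:: 16; 17; 18]; [:: 17; 11; 12]; [:: 17; 12; 13];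
    [:: 17; 13; 18]; [:: 18; 13; 14]; [:: 18; 14; 15]; [:: 7; 12; 13; 8];
    [:: 7; 8; 14; 15; 10]; [:: 16; 10; 7; 12; 17]; [:: 16; 11; 7; 9; 15];
    [:: 16; 11; 12; 13; 18]; [:: 16; 15; 14; 13; 17]; [:: 18; 13; 8; 9; 15];
    [:: 0; 7; 9; 14; 13; 1]; [:: 0; 7; 11; 17; 13; 1];
    [:: 8; 13; 12; 11; 10; 9]; [:: 16; 17; 13; 14; 9; 10];
    [:: 16; 18; 13; 8; 9; 10]; [:: 16; 18; 14; 8; 7; 10];
    [:: 16; 18; 14; 9; 7; 11]; [:: 17; 13; 14; 9; 10; 11];
    [:: 17; 13; 14; 15; 10; 11]; [:: 17; 18; 14; 8; 7; 12];
    [:: 17; 18; 14; 9; 7; 11]; [:: 17; 18; 14; 9; 10; 11];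
    [:: 17; 18; 15; 9; 7; 11]; [:: 17; 18; 15; 10; 7; 12];
    [:: 18; 15; 10; 11; 12; 13]; [:: 0; 1; 13; 14; 15; 10; 7];
    [:: 0; 1; 13; 18; 15; 9; 7]; [:: 16; 10; 7; 0; 1; 13; 17];
    [:: 16; 11; 7; 0; 1; 13; 18]; [:: 16; 11; 12; 13; 8; 9; 15];
    [:: 16; 15; 14; 8; 7; 12; 17]; [:: 16; 15; 14; 13; 1; 0; 7; 11];
    [:: 16; 17; 13; 1; 0; 7; 9; 15]].

Definition bipyramid_cycles : seq (seq nat) := [::
    [:: 0; 4; 5]; [:: 0; 4; 6]; [:: 1; 2; 5]; [:: 1; 2; 6]; [:: 3; 4; 5];
    [:: 3; 4; 6]; [:: 0; 6; 2; 5]; [:: 0; 6; 3; 5]; [:: 1; 6; 3; 5];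
    [:: 1; 6; 4; 5]; [:: 2; 6; 4; 5]; [:: 0; 1; 2; 3; 4]].

Definition second_copy (u : nat) : nat := if u < 2 then u + 2 else u + 12.

Definition T_cycles : seq (seq nat) :=
  gadget_cycles ++ map (map second_copy) gadget_cycles ++ bipyramid_cycles.

Lemma T_cyclesP (F : {set 'I_31}) c :
  induces_forest T F -> c \in T_cycles -> ~~ all (fun u => inord u \in F) c.
Proof.
move=> forest_F.
have ok : all (fun c => [&& 3 <= size c, uniq c, all (gtn 31) c & cycle adjn c])
  T_cycles by vm_compute.
move=> /(allP ok)/and4P[c3 uniq_c c31 cyc_c]; apply/negP => /allP c_F.
apply: (forest_F (map inord c)); first by move=> _ /mapP[u uc ->]; apply: c_F.
  by rewrite size_map.
split; last first.
  rewrite map_inj_in_uniq // => u v uc vc.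
  by apply: inord_inj; rewrite unfold_in; apply: (allP c31).
case: c c31 cyc_c {c3 uniq_c c_F} => //= u s /andP[u31 s31].
have us31 : all (gtn 31) (rcons s u) by rewrite all_rcons /= u31.
by rewrite -map_rcons; apply: path_inord adjn_inord _; apply/andP.
Qed.

(** The separate bounds add up to 6 + 6 + 4 = 16. One unit is saved in the first copy if [F]
    contains 0 and 1, in the second if it contains 2 and 3, and in the bipyramid otherwise. *)
Lemma forest_T_le15 (F : {set 'I_31}) : induces_forest T F -> #|F| <= 15.
Proof.
move=> /T_cyclesP avoid; pose f u : bool := inord u \in F.
have {}avoid c : c \in T_cycles -> ~~ all f c by exact: avoid.
have gadget1 c : c \in gadget_cycles -> ~~ all f c.
  by move=> cC; apply: avoid; rewrite mem_cat; apply/orP; left.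
have gadget2 c : c \in map (map second_copy) gadget_cycles -> ~~ all f c.
  move=> cC; apply: avoid; rewrite mem_cat; apply/orP; right.
  by rewrite mem_cat; apply/orP; left.
have base c : c \in bipyramid_cycles -> ~~ all f c.
  move=> cC; apply: avoid; rewrite mem_cat; apply/orP; right.
  by rewrite mem_cat; apply/orP; right.
have -> : #|F| = count f (iota 0 31).
  rewrite -sum1_card (eq_bigl (fun x : 'I_31 => f x)) => [|x].
    by rewrite -(big_mkord f (fun=> 1)) sum1_count.
  by rewrite /f inord_val.
rewrite -[iota 0 31]/(iota 0 7 ++ iota 7 12 ++ iota 19 12) !count_cat.
have le6 : count f (iota 7 12) < 7 by apply: hits_allP gadget1; vm_compute.
have le6' : count f (iota 19 12) < 7 by apply: hits_allP gadget2; vm_compute.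
have le4 : count f (iota 0 7) < 5 by apply: hits_allP base; vm_compute.
have le5 : f 0 && f 1 -> count f (iota 7 12) < 6.
  move=> f01; have : count f (iota 0 2 ++ iota 7 12) < 8.
    by apply: hits_allP gadget1; vm_compute.
  by case/andP: f01 => f0 f1; rewrite count_cat /= f0 f1 addnA.
have le5' : f 2 && f 3 -> count f (iota 19 12) < 6.
  move=> f23; have : count f (iota 2 2 ++ iota 19 12) < 8.
    by apply: hits_allP gadget2; vm_compute.
  by case/andP: f23 => f2 f3; rewrite count_cat /= f2 f3 addnA.
have [f01|nf01] := boolP (f 0 && f 1).
  by have := le5 f01; lia.
have [f23|nf23] := boolP (f 2 && f 3).
  by have := le5' f23; lia.
have : count f (iota 0 7) < 4; last by lia.
(* The assumptions of this case enter as two more sets that [F] cannot contain, although they are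
   not cycles. *)
apply: (@hits_allP ([:: 0; 1] :: [:: 2; 3] :: bipyramid_cycles)).
  by vm_compute.
move=> c; rewrite in_cons => /orP[/eqP->|]; first by rewrite /= andbT.
by rewrite in_cons => /orP[/eqP->|]; [rewrite /= andbT|exact: base].
Qed.

(** Listed in an elimination order: each vertex has at most one neighbour further on. *)
Definition T_forest : seq nat :=
  [:: 4; 11; 13; 15; 9; 7; 0; 1; 2; 25; 26; 21; 19; 23; 28].

Lemma T_forestP : induces_forest T [set x in map inord T_forest].
Proof.
apply: elimination_forest T_sym _ => s1 x s2 s_eq.
have ok : all (fun i => count (adjn (nth 0 T_forest i)) (drop i.+1 T_forest) <= 1)
  (iota 0 15) by vm_compute.
pose i := size s1.
have i15 : i < 15.
  have := congr1 size s_eq; rewrite size_map size_cat /= => ->.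
  by rewrite addnS ltnS leq_addr.
have T31 : all (gtn 31) T_forest by [].
have xE : x = inord (nth 0 T_forest i).
  by rewrite -(nth_map _ x) // s_eq nth_cat ltnn subnn.
have s2E : s2 = map inord (drop i.+1 T_forest).
  by rewrite map_drop s_eq -cat_rcons drop_size_cat // size_rcons.
rewrite s2E count_map; apply: leq_trans (all_iota ok i15).
rewrite (@eq_in_count _ _ (adjn (nth 0 T_forest i))) // => v /mem_drop vT.
rewrite /= T_adjn xE !inordK //; apply: (allP T31) => //; exact: mem_nth.
Qed.

Lemma T_forest_number : forest_number T = 15.
Proof.
apply/eqP; rewrite eqn_leq; apply/andP; split.
  by apply/bigmax_leqP => F /asboolP; apply: forest_T_le15.
apply: (bigop.bigmax_sup [set x in map inord T_forest]).
  by apply/asboolP; exact: T_forestP.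
rewrite cardsE (card_uniqP _) ?size_map //.
rewrite map_inj_in_uniq // => u v uT vT.
by apply: inord_inj; apply: (allP (_ : all (gtn 31) T_forest)).
Qed.

(* A straight-line drawing of [T] *)
Delimit Scope Z_scope with BZ.

(* A Tutte embedding, rounded and then compressed by local search. *)
Definition T_coords : seq (Z * Z) := [::
    (46, 7); (99, 81); (0, 81); (36, 15); (47, 48); (43, 0); (53, 79);
    (49, 16); (72, 45); (59, 34); (55, 40); (55, 63); (54, 76); (93, 77);
    (81, 65); (69, 54); (62, 56); (66, 72); (74, 69); (4, 77); (50, 76);
    (41, 73); (13, 72); (19, 54); (31, 28); (38, 34); (42, 58); (32, 68);
    (25, 63); (29, 45); (36, 51)]%BZ.

(** [det3] on binary integers, so that [vm_compute] decides the signs; [Z_embed] carries them to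
    [R]. *)
Definition detZ (p q r : Z * Z) : Z :=
  ((q.1 - p.1) * (r.2 - p.2) - (q.2 - p.2) * (r.1 - p.1))%BZ.

Definition T_side (u v w : nat) : Z :=
  let pos := nth (0, 0)%BZ T_coords in detZ (pos u) (pos v) (pos w).

Definition T_edge_separated (u v u' v' : nat) : bool :=
  (0 <? T_side u v u' * T_side u v v')%BZ
  || (0 <? T_side u' v' u * T_side u' v' v)%BZ.

Definition T_edge_pairs : seq (nat * nat) :=
  [seq (u, v) | u <- iota 0 31, v <- [seq v <- nth [::] T_nbrs u | u < v]].

Definition T_general_position : bool :=
  all (fun e => all (fun w => [|| w == e.1, w == e.2 |
                                  ~~ (T_side e.1 e.2 w =? 0)%BZ]) (iota 0 31))
    T_edge_pairs.

Definition T_edges_separated : bool :=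
  all (fun e => all (fun e' => [|| e.1 == e'.1, e.1 == e'.2, e.2 == e'.1,
      e.2 == e'.2 | T_edge_separated e.1 e.2 e'.1 e'.2])
    T_edge_pairs) T_edge_pairs.

Definition Z_embed (R : pzRingType) (z : Z) : R := (int_of_Z z)%:~R.

Lemma Z_embedB (R : pzRingType) y z :
  Z_embed R (y - z)%BZ = (Z_embed R y - Z_embed R z)%R.
Proof. by rewrite /Z_embed -rmorphB -rmorphB. Qed.

Lemma Z_embedM (R : pzRingType) y z :
  Z_embed R (y * z)%BZ = (Z_embed R y * Z_embed R z)%R.
Proof. by rewrite /Z_embed -rmorphM -rmorphM. Qed.

Lemma Z_embed_inj (R : numDomainType) : injective (Z_embed R).
Proof. by move=> y z /intr_inj /(can_inj int_of_ZK). Qed.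

Lemma Z_embed_gt0 (R : numDomainType) z :
  (0 <? z)%BZ -> (0 < Z_embed R z)%R.
Proof.
by case: z => // p _; rewrite /Z_embed ltr0n; apply/ssrnat.ltP; exact: Pos2Nat.is_pos.
Qed.

Definition T_pos (R : pzRingType) (x : 'I_31) : R * R :=
  let p := nth (0, 0)%BZ T_coords x in (Z_embed R p.1, Z_embed R p.2).

Lemma det3_T_pos (R : comRingType) x y z :
  det3 (T_pos R x) (T_pos R y) (T_pos R z) = Z_embed R (T_side x y z).
Proof. by rewrite /det3 /T_side /detZ !(Z_embedB, Z_embedM). Qed.

Lemma T_edge_pair (x y : 'I_31) : T x y ->
  (((x : nat), (y : nat)) \in T_edge_pairs)
  || (((y : nat), (x : nat)) \in T_edge_pairs).
Proof.
have lt_mem (u v : 'I_31) : adjn u v -> u < v ->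
    ((u : nat), (v : nat)) \in T_edge_pairs.
  move=> uv lt_uv; apply/allpairsPdep; exists (u : nat), (v : nat).
  by split; rewrite ?mem_iota ?ltn_ord // mem_filter lt_uv.
move=> xy; case: (ltngtP x y) => [lt_xy|lt_yx|/val_inj x_y].
- by rewrite lt_mem // -T_adjn.
- by rewrite [X in _ || X]lt_mem ?orbT // -T_adjn T_sym.
- by move: xy; rewrite x_y T_irr.
Qed.

Lemma T_planar (R : realType) : planar R T.
Proof.
have general : T_general_position by vm_compute.
have separated : T_edges_separated by vm_compute.
apply: (@straight_line_planar _ _ _
  (fun x y : 'I_31 => ((x : nat), (y : nat)) \in T_edge_pairs) (T_pos R)).
- exact: T_edge_pair.
- move=> x; have ok : all (fun e => e.1 != e.2) T_edge_pairs by vm_compute.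
  by apply/negP => /(allP ok); rewrite eqxx.
- move=> x y [/Z_embed_inj xy1 /Z_embed_inj xy2].
  have uniq_c : uniq T_coords by vm_compute.
  have size_c : size T_coords = 31 by [].
  apply: val_inj; apply/eqP; rewrite -(nth_uniq (0, 0)%BZ _ _ uniq_c) ?size_c;
    [|exact: ltn_ord..].
  by rewrite (surjective_pairing (nth _ _ x)) xy1 xy2 -surjective_pairing.
- move=> x y z /(allP general) /all_iota /(_ _ (ltn_ord z)) /=.
  rewrite det3_T_pos => side_z zxy; apply: contraTneq side_z => side0.
  have -> : T_side x y z = 0%BZ by apply: (@Z_embed_inj R); rewrite side0.
  by rewrite orbF !val_eqE; move: zxy; rewrite !inE.
- move=> x y u v /(allP separated) /allP sep_xy /sep_xy {sep_xy} /=.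
  rewrite !inE orbF !(negb_or, val_eqE) => sepZ /andP[/andP[xu xv] /andP[yu yv]].
  move: sepZ; rewrite (negbTE xu) (negbTE xv) (negbTE yu) (negbTE yv) !orFb.
  rewrite !det3_T_pos -!Z_embedM.
  case/orP => /(Z_embed_gt0 R) gt0; apply/orP; [left|right]; exact: gt0.
Qed.

(** * Maximality: the K5 in [T] with an added edge *)

(* The entry at x lists three neighbours of x which, together with x and any
   vertex y nonadjacent to x, are the branch vertices of a K5 in T + xy. *)
Definition T_link_triples : seq (nat * nat * nat) := [::
    (1, 4, 7); (0, 2, 8); (1, 3, 24); (2, 4, 24); (0, 3, 5); (0, 1, 2);
    (1, 12, 20); (0, 8, 9); (0, 1, 7); (7, 8, 10); (7, 9, 11); (7, 10, 12);
    (0, 6, 7); (1, 8, 12); (8, 9, 13); (9, 10, 14); (10, 11, 15);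
    (11, 12, 13); (13, 14, 15); (2, 20, 21); (2, 6, 19); (19, 20, 22);
    (19, 21, 23); (19, 22, 24); (2, 3, 19); (3, 20, 24); (20, 21, 25);
    (21, 22, 26); (22, 23, 27); (23, 24, 25); (25, 26, 27)].


(** One round of breadth-first search; walks are stored from the vertex reached back to the common
    target. *)
Definition extend_walks (blocked : seq nat) (ws : seq (seq nat)) :=
  let reached := map (head 0) ws in
  ws ++ pmap (fun v =>
      if [seq w <- ws | adjn v (head 0 w)] is w :: _ then Some (v :: w)
      else None)
    [seq v <- iota 0 31 | (v \notin blocked) && (v \notin reached)].

(** The walks are certified afterwards by [K5_check]: a branch vertex not reached in eight rounds
    would yield the empty walk and be rejected. *)
Definition walks_to (t : nat) (blocked : seq nat) : seq (seq nat) :=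
  iter 8 (extend_walks blocked) [:: [:: t]].

Definition walk_from (v : nat) (ws : seq (seq nat)) : seq nat :=
  behead (head [::] [seq w <- ws | head 0 w == v]).

Definition K5_check (adj : rel nat) (b : seq nat) (P : seq (seq (seq nat))) :=
  let B i := nth 0 b i in let W i j := nth [::] (nth [::] P i) j in
  let pairs := [seq (i, j) | i <- iota 0 5, j <- iota i.+1 (4 - i)] in
  [&& all (gtn 31) b,
      all (fun p => [&& path adj (B p.1) (W p.1 p.2),
        last (B p.1) (W p.1 p.2) == B p.2, B p.1 != B p.2 &
        all (gtn 31) (W p.1 p.2)]) pairs &
      all (fun p => all (fun q =>
        (p.1 < q.1) && uniq [:: p.1; p.2; q.1; q.2] ==>
        ~~ has [in B q.1 :: W q.1 q.2] (B p.1 :: W p.1 p.2)) pairs) pairs].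

(** [a], [b], [c] are joined by walks among the neighbours of [x], and [y] reaches each of them by a
    walk avoiding [x] and the walk between the other two. *)
Definition T_K5_check (x : nat) : bool :=
  let: (a, b, c) := nth (0, 0, 0) T_link_triples x in
  let outside := [seq v <- iota 0 31 | ~~ adjn x v] in
  let arc u v w := walk_from u (walks_to v (w :: outside)) in
  let ab := arc a b c in let ac := arc a c b in let bc := arc b c a in
  let to_a := walks_to a [:: x, b, c & bc] in
  let to_b := walks_to b [:: x, a, c & ac] in
  let to_c := walks_to c [:: x, a, b & ab] in
  all (fun y => (y == x) || adjn x y ||
      K5_check (fun u v => adjn u v || (u == x) && (v == y))
       [:: x; y; a; b; c]
       [:: [:: [::]; [:: y]; [:: a]; [:: b]; [:: c]];
           [:: [::]; [::]; walk_from y to_a; walk_from y to_b; walk_from y to_c];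
           [:: [::]; [::]; [::]; ab; ac];
           [:: [::]; [::]; [::]; [::]; bc]]) (iota 0 31).


Lemma K5_checkP (R : realType) (adj : rel nat) (e : rel 'I_31) b P :
  {in gtn 31 &, forall v w, adj v w -> e (inord v) (inord w)} ->
  K5_check adj b P -> ~ planar R e.
Proof.
move=> adj_e /and3P[b31 walksP disjP].
have pairsP i j : i < j < 5 ->
    (i, j) \in [seq (i, j) | i <- iota 0 5, j <- iota i.+1 (4 - i)].
  have ok : all (fun j => all (fun i => (i, j) \in
    [seq (i, j) | i <- iota 0 5, j <- iota i.+1 (4 - i)]) (iota 0 j)) (iota 0 5).
    by vm_compute.
  by case/andP => ij j5; exact: (all_iota (all_iota ok j5) ij).
(* The default 0 of [nth] is also a vertex, so every index is covered. *)
have B31 i : nth 0 b i < 31.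
  have [ib|/(nth_default 0)->//] := ltnP i (size b).
  exact: (allP b31 _ (mem_nth 0 ib)).
have mem_walk i j : i < j < 5 -> all (gtn 31) (nth 0 b i :: nth [::] (nth [::] P i) j).
  move=> /pairsP /(allP walksP) /and4P[_ _ _ W31].
  by apply/andP; split; [exact: B31|].
apply: (@K5_nonplanar _ _ _ (fun i => inord (nth 0 b i))
  (fun i j => map inord (nth [::] (nth [::] P i) j))).
- move=> i j ij; have /and4P[/= pW lW neq W31] := allP walksP _ (pairsP _ _ ij).
  split; first exact: path_inord adj_e (mem_walk _ _ ij) pW.
    by rewrite last_map (eqP lW).
  by apply: contra neq => /eqP eq_ij; apply/eqP; exact: inord_inj (B31 i) (B31 j) eq_ij.
- move=> i j k l ij kl ik ijkl.
  have /implyP/(_ _)/hasPn dis :=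
    allP (allP disjP _ (pairsP _ _ ij)) _ (pairsP _ _ kl).
  rewrite -!map_cons; apply/hasPn => _ /mapP[u u_ij ->]; apply/mapP => -[v v_kl].
  have u31 := allP (mem_walk _ _ ij) _ u_ij.
  have v31 := allP (mem_walk _ _ kl) _ v_kl.
  move=> /(inord_inj u31 v31) uv; move: v_kl; rewrite -uv.
  by apply/negP; apply: dis u_ij; apply/andP.
Qed.

Lemma T_maximal_planar (R : realType) : maximal_planar R T.
Proof.
split=> [|x y xy nTxy]; first exact: T_planar.
have ok : all T_K5_check (iota 0 31) by vm_compute.
move: (all_iota ok (ltn_ord x)); rewrite /T_K5_check.
case: (nth _ _ _) => [[a b] c] /all_iota /(_ _ (ltn_ord y)).
rewrite -val_eqE eq_sym in xy; rewrite T_adjn in nTxy.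
move=> /orP[/orP[yx|adj_xy]|]; first by rewrite yx in xy.
  by rewrite adj_xy in nTxy.
apply: K5_checkP => v w v31 w31 /orP[vw|/andP[/eqP -> /eqP ->]]; apply/orP.
  by left; exact: adjn_inord.
right; rewrite !inord_val; exact: eqxx.
Qed.

Theorem proposition5p1 (R : realType) :
  [/\ simple_graph T /\ maximal_planar R T,
      #|{: 'I_31}| = 31,
      #|edges T| = 87,
      forest_number T = 15
    & perm_eq [seq degree T x | x : 'I_31]
        (nseq 1 4 ++ nseq 17 5 ++ nseq 6 6 ++ nseq 7 7)].
Proof.
split.
- by split; [split; [exact: T_sym|exact: T_irr]|exact: T_maximal_planar].
- by rewrite card_ord.
- exact: T_edge_count.
- exact: T_forest_number.
- exact: T_degree_sequence.
Qed.
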